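(* Let $G$ be a finite nilpotent group. If $H$ is a finite group and $\Lambda^*(H)=\Lambda^*(G)$, then $H$ is nilpotent.
   Context: For a finite group $G$ and non-negative integers $a\leq b$, $\Gamma_{a,b}(G)$ is the undirected graph, possibly with loops, whose vertices are the elements of $G^a\cup G^b$ (a disjoint union if $a\neq b$, just $G^a$ if $a=b$; $G^0$ consists of the single empty tuple), in which $(x_1,\dots,x_a)\in G^a$ and $(y_1,\dots,y_b)\in G^b$ are adjacent if and only if $\langle x_1,\dots,x_a,y_1,\dots,y_b\rangle=G$. If $a\neq b$ there are no other edges; if $a=b$ there is a loop at $x\in G^a$ exactly when the entries of $x$ generate $G$. A vertex is isolated if it is adjacent to no vertex (itself included). $\Gamma^*_{a,b}(G)$ is obtained from $\Gamma_{a,b}(G)$ by deleting the isolated vertices. $\Lambda^*(G)$ is the collection of all the connected components of the graphs $\Gamma^*_{a,b}(G)$, for all non-negative integers $a\leq b$, regarded as abstract graphs (with their loops) up to isomorphism and counted with multiplicity; the labels $a,b$ from which each graph arises are not part of the data. Thus $\Lambda^*(G)=\Lambda^*(H)$ means that there is a bijection between the two collections matching isomorphic graphs. *)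

(* Defs.v *)
From mathcomp Require Import all_boot all_fingroup all_solvable.

Set Implicit Arguments.
Unset Strict Implicit.
Unset Printing Implicit Defensive.

(* Finite undirected graphs, loops allowed (adj need not be irreflexive). *)
Record graph := Graph {
  vertex :> finType;
  adj : rel vertex;
  adjC : symmetric adj
}.

Definition graph_iso (X Y : graph) : Prop :=
  exists2 f : X -> Y, bijective f & forall x y, adj (f x) (f y) = adj x y.

Section Subgraphs.
Variable X : graph.

Definition induced_adj (A : {set X}) : rel {x : X | x \in A} :=
  fun x y => adj (val x) (val y).

Lemma induced_adjC (A : {set X}) : symmetric (@induced_adj A).
Proof. by move=> x y; apply: adjC. Qed.

Definition induced (A : {set X}) : graph := Graph (@induced_adjC A).

(* A vertex whose only neighbour is itself is not isolated. *)
Definition isolated (x : X) : bool := [forall y, ~~ adj x y].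

Definition delete_isolated : graph := induced [set x | ~~ isolated x].

Definition components : {set {set X}} :=
  [set [set y | connect (@adj X) x y] | x in [set: X]].

End Subgraphs.

Section GeneratingGraph.
Variables (gT : finGroupType) (G : {group gT}) (a b : nat).

(* When a <= b, the union of G^a and G^b is taken inside the sequences of     *)
(* length at most b: it is disjoint for a <> b, and just G^a for a = b.       *)
Definition Gamma_vertex : finType :=
  {s : b.-bseq gT |
    ((size s == a) || (size s == b)) && all [in G] s}.

Definition Gamma_adj : rel Gamma_vertex := fun s t =>
  ((size (val s) == a) && (size (val t) == b)
   || (size (val s) == b) && (size (val t) == a))
  && (<<[set x in val s ++ val t]>>%g == G :> {set gT}).

Lemma Gamma_adjC : symmetric Gamma_adj.
Proof.
move=> s t; rewrite /Gamma_adj orbC ![(size (val s) == _) && _]andbC.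
by congr (_ && (<<_>>%g == _)); apply/setP=> x; rewrite !inE !mem_cat orbC.
Qed.

Definition Gamma : graph := Graph Gamma_adjC.

Definition Gamma_star : graph := delete_isolated Gamma.

End GeneratingGraph.

(* The members of the collection are indexed by the triples (a, b, C) with    *)
(* a <= b and C a component of Gamma_star G a b, which accounts for           *)
(* multiplicities.                                                            *)
Record Lambda_star (gT : finGroupType) (G : {group gT}) := LambdaStar {
  Lambda_a : nat;
  Lambda_b : nat;
  Lambda_le : Lambda_a <= Lambda_b;
  Lambda_comp : {set Gamma_star G Lambda_a Lambda_b};
  Lambda_compP : Lambda_comp \in components (Gamma_star G Lambda_a Lambda_b)
}.

Definition Lambda_graph (gT : finGroupType) (G : {group gT})
    (c : Lambda_star G) : graph :=
  induced (Lambda_comp c).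

Definition same_Lambda_star (gT hT : finGroupType)
    (G : {group gT}) (H : {group hT}) : Prop :=
  exists2 f : Lambda_star G -> Lambda_star H,
    bijective f & forall c, graph_iso (Lambda_graph c) (Lambda_graph (f c)).

(* Main.v *)
Require Import Defs.
From mathcomp Require Import all_boot all_fingroup all_solvable.

Set Implicit Arguments.
Unset Strict Implicit.
Unset Printing Implicit Defensive.

Import GroupScope.

(** Let n >= |G|. The graph Gamma_{n,n}(G) alone decides whether G is
nilpotent, for the following reasons.

Write x _|_ y when the n-tuples x and y do not generate G together. If x
generates a maximal subgroup M, the set of all y with x _|_ y is exactly M^n,
and since n >= |G| every M arises in this way. In general the set of all y with
x _|_ y, when it is not empty, contains some M^n, because x together with one
such y lies in a maximal subgroup. Hence the sets M^n, with M maximal, are the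
minimal nonempty non-neighbourhoods of the graph ([facetP]), and the cardinals
|G|^n, |M|^n and |M1 :&: M2|^n are invariants of the abstract graph. After
taking n-th roots, the graph knows whether
  |M1 :&: M2| |G| = |M1| |M2|   for all distinct maximal M1, M2,
that is, whether M1 M2 = G for all such M1, M2. This condition is equivalent to
nilpotency ([maximal_index_nilpotentP]): in a nilpotent group every maximal
subgroup is normal, so that M1 M2 is a subgroup; conversely M M^x is never G,
so that the condition forces every maximal subgroup to be normal.

It remains to find such graphs inside the collection. A component with a loop
can only come from a = b, and the tuple at the loop generates G, so it is
adjacent to all the others: the component is all of Gamma_{b,b}(G)
([loop_component_model]). Thus Gamma_{n,n}(H) is matched with Gamma_{m,m}(G)
for some m. Nothing ties m to n directly, but the numbers of vertices give
|H|^n = |G|^m, and n = |H| + |G|^|G| is large enough to force m >= |G|. *)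

(** * Maximal subgroups and nilpotency *)

Section MaximalSubgroups.
Variable gT : finGroupType.
Implicit Types G H K M P : {group gT}.

Lemma nilpotent_maximal_normal G M : nilpotent G -> maximal M G -> M <| G.
Proof.
move=> nilG /maxgroupP[pM maxM]; rewrite /normal (proper_sub pM) /=.
have pMN := nilpotent_proper_norm nilG pM.
apply/setIidPl/eqP; rewrite eqEproper subsetIl /=.
apply/negP=> pNG; have := maxM 'N_G(M)%G pNG (proper_sub pMN) => /= defN.
by rewrite defN properxx in pMN.
Qed.

(** If the normalizer of a Sylow subgroup were proper, it would lie in a normal
maximal subgroup M, and the Frattini argument would give M = G. So all Sylow
subgroups are normal, and the Fitting subgroup, which contains them, is G. *)
Lemma maximal_normal_nilpotent G :
  (forall M, maximal M G -> M <| G) -> nilpotent G.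
Proof.
move=> nsmax; have sylF p P : p.-Sylow(G) P -> P \subset 'F(G).
  move=> sylP; apply: Fitting_max (pgroup_nil (pHall_pgroup sylP)).
  rewrite /normal (pHall_sub sylP) /=; apply/setIidPl.
  have [// | [M maxM sNM]] := maximal_exists (subsetIl G 'N(P)).
  have sPM: P \subset M.
    by apply: subset_trans sNM; rewrite subsetI (pHall_sub sylP) normG.
  have sMG := proper_sub (maxgroupp maxM).
  have defG := Frattini_arg (nsmax M maxM) (pHall_subl sPM sMG sylP).
  have sGM: G \subset M by rewrite -defG (mulGSid sNM).
  by have := maxgroupp maxM; rewrite /= properE sGM andbF.
have: #|G| %| #|'F(G)|.
  apply/dvdn_partP=> // p _; have [P sylP] := Sylow_exists p G.
  by rewrite -(card_Hall sylP) cardSg ?(sylF p).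
move/(dvdn_leq (cardG_gt0 _)) => leGF.
apply: nilpotentS (Fitting_nil G).
by have /eqP->: 'F(G) == G :> {set gT} by rewrite eqEcard Fitting_sub.
Qed.

(** By the product formula, the equality of cardinals says M1 M2 = G. It fails
for M and a different conjugate M^x: from x = y z^x, with y and z in M, it
follows that x = z y is in M. *)
Lemma maximal_index_nilpotentP G :
  (forall M1 M2, maximal M1 G -> maximal M2 G -> M1 :!=: M2 ->
     (#|M1 :&: M2| * #|G| = #|M1| * #|M2|)%N) <-> nilpotent G.
Proof.
split=> [indG | nilG M1 M2 maxM1 maxM2 neM].
  apply: maximal_normal_nilpotent => M maxM.
  have sMG := proper_sub (maxgroupp maxM).
  rewrite /normal sMG /=; apply/subsetP=> x Gx; rewrite inE.
  suff /eqP->: M :^ x == M by [].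
  apply: contraT; rewrite eq_sym => neMx.
  have maxMx: maximal (M :^ x)%G G by rewrite -(conjGid Gx) maximalJ.
  have := mul_cardG M (M :^ x)%G.
  rewrite -(indG _ _ maxM maxMx neMx) mulnC => /eqP.
  rewrite eqn_pmul2r ?cardG_gt0 // => /eqP cardMM.
  have defG: M * M :^ x = G.
    apply/eqP; rewrite eqEcard cardMM leqnn andbT.
    by rewrite mul_subG // (proper_sub (maxgroupp maxMx)).
  have: x \in M * M :^ x by rewrite defG.
  case/mulsgP=> y _ My /imsetP[z Mz ->] def_x.
  have zx: z ^ x = y^-1 * x by rewrite {2}def_x mulKg.
  have defz: z = x * y^-1 by apply: (mulIg x); rewrite conjgC zx mulgA.
  have Mx: x \in M by rewrite -(mulgKV y x) -defz groupM.
  by rewrite conjGid ?eqxx in neMx.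
have nsM1 := nilpotent_maximal_normal nilG maxM1.
have sM2G := proper_sub (maxgroupp maxM2).
rewrite [RHS]mul_cardG mulnC (mulg_normal_maximal nsM1) //.
apply: contra neM => sM21.
by rewrite eq_sym (maxgroupP maxM2).2 ?(maxgroupp maxM1).
Qed.

End MaximalSubgroups.

(** * Minimal non-neighbourhoods in a graph *)

Section Facets.
Variable X : graph.

Definition non_neighbours (x : X) : {set X} := [set y | ~~ adj x y].

Definition facet (A : {set X}) : bool :=
  minset (fun B => (B != set0) && (B \in codom non_neighbours)) A.

(** When the facets are the sets M^n for the maximal subgroups M, and the
vertices are G^n, these are the n-th powers of the equalities
|M1 :&: M2| |G| = |M1| |M2|. *)
Definition transverse_facets : Prop :=
  forall A B, facet A -> facet B -> A != B ->
    (#|A :&: B| * #|X| = #|A| * #|B|)%N.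

End Facets.

Lemma graph_iso_transverse (X Y : graph) :
  graph_iso X Y -> transverse_facets Y -> transverse_facets X.
Proof.
case=> f bij_f adj_f trY; have inj_f := bij_inj bij_f.
have nn_f x : non_neighbours (f x) = f @: non_neighbours x.
  apply/setP=> y; have [g fK gK] := bij_f.
  by rewrite -[y]gK mem_imset // !inE adj_f.
have facet_f A : facet A -> facet (f @: A).
  case/minsetP=> /andP[A0 /codomP[x defA]] minA; apply/minsetP.
  split=> [|B /andP[B0 /codomP[y defB]] sBA].
    by rewrite -card_gt0 card_imset // card_gt0 A0 defA -nn_f codom_f.
  have [g fK gK] := bij_f; rewrite -[y]gK nn_f in defB.
  have sBA' : non_neighbours (g y) \subset A.
    apply/subsetP=> z z_y; rewrite -(mem_imset _ _ inj_f).
    by rewrite (subsetP sBA) // defB imset_f.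
  rewrite defB (minA _ _ sBA') // codom_f andbT.
  by apply: contra B0 => /eqP y0; rewrite defB y0 imset0.
move=> A B facA facB neAB; rewrite -[#|X|](card_imset _ inj_f) /=.
have ->: #|f @: X| = #|Y|.
  by rewrite card_imset // (bij_eq_card bij_f).
rewrite -(card_imset A inj_f) -(card_imset B inj_f) -(card_imset _ inj_f).
rewrite imsetI; last by move=> ? ? _ _; apply: inj_f.
by apply: trY; rewrite ?facet_f ?(inj_eq (imset_inj inj_f)).
Qed.

(** * Tuples generating a subgroup *)

Section GeneratingTuples.
Variable gT : finGroupType.
Implicit Types (s t : seq gT) (K : {group gT}).

Lemma seq_gen_subG s K :
  (<<[set z in s]>> \subset K) = all [in K] s.
Proof.
rewrite gen_subG; apply/subsetP/allP=> sK z; last by rewrite inE => /sK.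
by move=> sz; apply: sK; rewrite inE.
Qed.

Lemma seq_gen_cat s t :
  <<[set z in s ++ t]>> = <<[set z in s]>> <*> <<[set z in t]>>.
Proof.
rewrite joing_idl joing_idr; congr <<_>>.
by apply/setP=> z; rewrite !inE mem_cat.
Qed.

Lemma card_tuple_in n K :
  #|[set t : n.-tuple gT | all [in K] t]| = (#|K| ^ n)%N.
Proof.
have <-: #|{: subg_of K}| = #|K| by rewrite card_sub.
rewrite -card_tuple.
have inj_val: injective (map_tuple (n := n) (@sgval _ K)).
  by move=> s t /(congr1 val)/(inj_map subg_inj)/val_inj.
rewrite -(card_imset _ inj_val); apply: eq_card => t; rewrite inE.
apply/idP/imsetP=> [/allP Kt | [s _ ->]]; last first.
  by apply/allP=> z /mapP[u _ ->]; apply: subgP.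
exists (map_tuple (subg K) t) => //; apply: val_inj => /=.
by rewrite -map_comp map_id_in // => z /Kt Kz /=; rewrite subgK.
Qed.

(** A list of the elements of K, padded with the identity, has any prescribed
length from |K| on. *)
Lemma generating_tuple n K :
  #|K| <= n -> exists t : n.-tuple gT, <<[set z in t]>> = K.
Proof.
move=> leKn; pose s := enum K ++ nseq (n - #|K|) 1.
have size_s: size s == n by rewrite size_cat size_nseq -cardE subnKC.
exists (Tuple size_s); apply/eqP; rewrite eqEsubset seq_gen_subG.
apply/andP; split.
  apply/allP=> z; rewrite mem_cat mem_enum mem_nseq.
  by case/orP=> [|/andP[_ /eqP->]].
by apply/subsetP=> z Kz; apply: mem_gen; rewrite inE mem_cat mem_enum Kz.
Qed.

End GeneratingTuples.

(** * The graph on the n-tuples of a group *)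

Section TupleModel.
Variables (gT : finGroupType) (G : {group gT}) (n : nat).
Implicit Types K L M : {group gT}.

(** An identification of X with Gamma_{n,n}(G). It hides the nested subtypes
through which the members of the collection are built. *)
Definition tuple_model (X : graph) (e : X -> n.-tuple gT) : Prop :=
  [/\ injective e,
      forall t, (t \in codom e) = all [in G] t
    & forall x y,
        adj x y = (<<[set z in e x ++ e y]>> == G :> {set gT})].

Variables (X : graph) (e : X -> n.-tuple gT).
Hypothesis modX : tuple_model e.

Definition tuples_in K : {set X} := [set x | all [in K] (e x)].

Lemma card_tuples_in K : K \subset G -> #|tuples_in K| = (#|K| ^ n)%N.
Proof.
have [inj_e im_e _] := modX => sKG.
rewrite -card_tuple_in -(card_imset _ inj_e); apply: eq_card => t.
rewrite inE; apply/imsetP/idP=> [[x Kx ->] | Kt]; first by rewrite inE in Kx.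
have: t \in codom e by rewrite im_e; apply: sub_all Kt => z /(subsetP sKG).
by case/codomP=> x def_t; exists x => //; rewrite inE -def_t.
Qed.

Lemma card_model : #|X| = (#|G| ^ n)%N.
Proof.
have [_ im_e _] := modX; rewrite -(card_tuples_in (subxx G)).
suff ->: tuples_in G = setT by rewrite cardsT.
by apply/setP=> x; rewrite in_setT inE -[LHS](im_e (e x)) codom_f.
Qed.

Lemma tuples_inI K M : tuples_in K :&: tuples_in M = tuples_in (K :&: M).
Proof.
by apply/setP=> x; rewrite !inE -all_predI; apply: eq_all => z; rewrite !inE.
Qed.

Hypothesis le_G_n : #|G| <= n.

Lemma generating_vertex K :
  K \subset G -> exists x, <<[set z in e x]>> = K.
Proof.
move=> sKG; have leKn := leq_trans (subset_leq_card sKG) le_G_n.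
have [t gent] := generating_tuple leKn; have [_ im_e _] := modX.
suff /codomP[x def_t]: t \in codom e by exists x; rewrite -def_t.
by rewrite im_e -seq_gen_subG gent.
Qed.

Lemma non_neighbours_maximal M x :
  maximal M G -> <<[set z in e x]>> = M -> non_neighbours x = tuples_in M.
Proof.
have [_ im_e adjE] := modX => maxM genM; have [pMG maxM'] := maxgroupP maxM.
apply/setP=> y; rewrite !inE adjE seq_gen_cat genM -seq_gen_subG.
apply/negP/idP=> [ngen | sM /eqP].
  have yG: <<[set z in e y]>> \subset G by rewrite seq_gen_subG -im_e codom_f.
  have joinG: M <*> <<[set z in e y]>> \subset G.
    by rewrite join_subG proper_sub.
  have [defG | [L maxL sML]] := maximal_exists joinG.
    by case: ngen; apply/eqP.
  rewrite join_subG in sML; case/andP: sML => sML.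
  by rewrite (maxM' L (maxgroupp maxL) sML).
by rewrite (joing_idPl sM) => eqMG; rewrite eqMG properxx in pMG.
Qed.

(** Testing the inclusion on a tuple that generates M1 recovers M1 from the set
of its tuples. *)
Lemma tuples_in_sub M1 M2 :
  maximal M1 G -> maximal M2 G -> tuples_in M1 \subset tuples_in M2 ->
  M1 :=: M2.
Proof.
move=> maxM1 maxM2 sM12.
have [x genx] := generating_vertex (proper_sub (maxgroupp maxM1)).
have: x \in tuples_in M2.
  by rewrite (subsetP sM12) // inE -seq_gen_subG genx.
rewrite inE -seq_gen_subG genx => sM; apply/esym.
by case/maxgroupP: maxM1 => _; apply; rewrite ?(maxgroupp maxM2).
Qed.

(** A tuple x and one of its non-neighbours lie in a common maximal subgroup M,
and no tuple of M helps x to generate G. *)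
Lemma non_neighbours_sup x :
  non_neighbours x != set0 ->
  exists2 M : {group gT}, maximal M G & tuples_in M \subset non_neighbours x.
Proof.
have [_ im_e adjE] := modX; case/set0Pn=> y; rewrite inE adjE => ngen.
have inG z : <<[set w in e z]>> \subset G by rewrite seq_gen_subG -im_e codom_f.
have joinG: <<[set w in e x ++ e y]>> \subset G.
  by rewrite seq_gen_cat join_subG !inG.
have [defG | [M maxM sM]] := maximal_exists joinG; first by case/eqP: ngen.
exists M => //; apply/subsetP=> z; rewrite !inE adjE -seq_gen_subG => zM.
rewrite /= seq_gen_cat join_subG in sM; case/andP: sM => xM _.
apply: contraL (maxgroupp maxM) => /eqP defG.
by rewrite -defG seq_gen_cat properE join_subG xM zM andbF.
Qed.

(** M^n is the non-neighbourhood of a tuple that generates M. It is minimal: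
a smaller nonempty one would contain L^n for another maximal subgroup L, but
then L = M. *)
Lemma tuples_in_facet M : maximal M G -> facet (tuples_in M).
Proof.
move=> maxM; have [x genx] := generating_vertex (proper_sub (maxgroupp maxM)).
have defM := non_neighbours_maximal maxM genx.
apply/minsetP; split=> [|B /andP[B0 /codomP[y defB]] sBM].
  rewrite -defM codom_f andbT; apply/set0Pn; exists x.
  by rewrite defM inE -seq_gen_subG genx.
rewrite defB in B0 sBM *; have [L maxL sL] := non_neighbours_sup B0.
apply/eqP; rewrite eqEsubset sBM.
by have <-: tuples_in L = tuples_in M
  by rewrite /tuples_in (tuples_in_sub maxL maxM (subset_trans sL sBM)).
Qed.

Lemma facetP A :
  reflect (exists2 M : {group gT}, maximal M G & A = tuples_in M) (facet A).
Proof.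
apply: (iffP idP) => [facA | [M maxM ->]]; last exact: tuples_in_facet.
have /andP[A0 /codomP[x defA]] := minsetp facA.
rewrite defA in A0; have [M maxM sMA] := non_neighbours_sup A0.
exists M => //; rewrite -defA in sMA; apply/esym.
exact: minsetinf facA (minsetp (tuples_in_facet maxM)) sMA.
Qed.

Lemma transverse_nilpotentP : transverse_facets X <-> nilpotent G.
Proof.
have n_gt0: 0 < n := leq_trans (cardG_gt0 G) le_G_n.
have facet_cards M1 M2 : maximal M1 G -> maximal M2 G ->
    (#|tuples_in M1 :&: tuples_in M2| * #|X|
       = #|tuples_in M1| * #|tuples_in M2|)%N
    <-> (#|M1 :&: M2| * #|G| = #|M1| * #|M2|)%N.
  move=> /maxgroupp/proper_sub sM1 /maxgroupp/proper_sub sM2.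
  have sM12: M1 :&: M2 \subset G by rewrite subIset ?sM1.
  rewrite tuples_inI !card_tuples_in // card_model -!expnMn.
  by split=> [/eqP | ->//]; rewrite eqn_exp2r // => /eqP.
apply: iff_trans (maximal_index_nilpotentP G).
split=> [trX M1 M2 maxM1 maxM2 neM | indG A B].
  apply/facet_cards=> //; apply: trX; try exact: tuples_in_facet.
  by apply: contra neM => /eqP eqM; rewrite (tuples_in_sub maxM1 maxM2) // eqM.
move=> /facetP[M1 maxM1 ->] /facetP[M2 maxM2 ->] neM.
apply/facet_cards=> //; apply: indG => //.
by apply: contra neM => /eqP eqM; rewrite /tuples_in eqM.
Qed.

End TupleModel.

(** * Components with a loop *)

(** A loop joins a tuple of length a to a tuple of length b, so a = b. The tuple
at the loop generates G and is therefore adjacent to every b-tuple, so that none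
is isolated or in another component. *)
Lemma loop_component_model (gT : finGroupType) (G : {group gT})
    (c : Lambda_star G) (x : Lambda_graph c) :
  adj x x -> exists e : Lambda_graph c -> (Lambda_b c).-tuple gT,
    tuple_model G e.
Proof.
case: c x => a b leab C CP /= x.
rewrite /induced_adj /= /induced_adj /= /Gamma_adj.
case/andP=> sizes /eqP genx.
have eqab: a = b by case/orP: sizes => /andP[/eqP-> /eqP].
subst a; rewrite seq_gen_cat (joing_idPl (subxx _)) in genx.
have size_e (y : {y | y \in C}) : size (val (val (val y))) == b.
  by have := valP (val (val y)); rewrite orbb => /andP[].
exists (fun y => Tuple (size_e y)); split=> [y z | t | y z].
- by move/(congr1 val)=> eq_yz; do 4!apply: val_inj; exact: eq_yz.
- apply/codomP/idP=> [[y ->] | Gt].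
    by case/andP: (valP (val (val y))).
  have t_le: size t <= b by rewrite size_tuple.
  have t_vertex: ((size (Bseq t_le) == b) || (size (Bseq t_le) == b))
                   && all [in G] (Bseq t_le).
    by rewrite /= size_tuple eqxx.
  pose v : Gamma G b b := Sub (Bseq t_le) t_vertex.
  pose u : Gamma G b b := val (val x).
  have adjuv: adj u v.
    rewrite /= /Gamma_adj /= size_tuple eqxx (size_e x) /=.
    by rewrite seq_gen_cat genx (joing_idPl _) // seq_gen_subG.
  have v_ok: v \in [set y | ~~ isolated y].
    by rewrite inE; apply/forallPn; exists u; rewrite negbK adjC.
  pose w : Gamma_star G b b := Sub v v_ok.
  have wC: w \in C.
    case/imsetP: CP => z _ defC.
    have: (val x : Gamma_star G b b) \in C := valP x.
    (* The type of x depends on C, which is about to be rewritten. *)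
    move: (val x) @u adjuv => u' u adjuv.
    rewrite defC !inE => zx; apply: connect_trans zx (connect1 _).
    exact: adjuv.
  by exists (Sub w wC); apply: val_inj.
by rewrite /= /induced_adj /= /induced_adj /= /Gamma_adj !(eqP (size_e _)) eqxx.
Qed.

Lemma loop_component_exists (gT : finGroupType) (G : {group gT}) n :
  #|G| <= n ->
  exists2 c : Lambda_star G, Lambda_b c = n
            & exists x : Lambda_graph c, adj x x.
Proof.
move=> leGn; have [t gent] := generating_tuple leGn.
have t_le: size t <= n by rewrite size_tuple.
have t_vertex: ((size (Bseq t_le) == n) || (size (Bseq t_le) == n))
                 && all [in G] (Bseq t_le).
  by rewrite /= size_tuple eqxx -seq_gen_subG gent subxx.
pose v : Gamma G n n := Sub (Bseq t_le) t_vertex.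
have loopv: adj v v.
  rewrite /= /Gamma_adj /= size_tuple eqxx /= seq_gen_cat.
  by rewrite (joing_idPl (subxx _)); apply/eqP.
have v_ok: v \in [set y | ~~ isolated y].
  by rewrite inE; apply/forallPn; exists v; rewrite negbK.
pose w : Gamma_star G n n := Sub v v_ok.
have wC: [set y | connect (@adj _) w y] \in components (Gamma_star G n n).
  exact: imset_f.
exists (LambdaStar (leqnn n) wC) => //.
have ww: w \in [set y | connect (@adj _) w y] by rewrite inE connect0.
by exists (Sub w ww).
Qed.

Theorem theorem5p16 (gT hT : finGroupType) (G : {group gT}) (H : {group hT}) :
  nilpotent G -> same_Lambda_star H G -> nilpotent H.
Proof.
move=> nilG [f _ isof].
have [-> | ntH] := eqVneq (H : {set hT}) 1; first exact: nilpotent1.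
pose n := (#|H| + #|G| ^ #|G|)%N.
have leHn: #|H| <= n by apply: leq_addr.
have [c bc [x loopx]] := loop_component_exists leHn.
have [e modc] := loop_component_model loopx.
have [phi bij_phi adj_phi] := isof c.
have [e' modfc] := loop_component_model (etrans (adj_phi x x) loopx).
have leGm: #|G| <= Lambda_b (f c).
  (* If m < |G| then |G|^m <= |G|^|G| <= n < |H|^n. *)
  have := card_model modfc; rewrite -(bij_eq_card bij_phi) (card_model modc) bc.
  apply: contra_eqT; rewrite -ltnNge => ltmG; rewrite gtn_eqF //.
  apply: (@leq_ltn_trans n).
    by rewrite (leq_trans _ (leq_addl _ _)) // leq_pexp2l // ltnW.
  by apply: ltn_expl; rewrite cardG_gt1.
have leHb: #|H| <= Lambda_b c by rewrite bc.
apply/(transverse_nilpotentP modc leHb); apply: graph_iso_transverse (isof c) _.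
exact/(transverse_nilpotentP modfc leGm).
Qed.
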